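(* Let $0<q<1$, $x\in\mathbb{R}$ with $|x|<1$, $r,s\geq 0$, and $k_1,\dots,k_r,\ell_1,\dots,\ell_s\in\mathbb{N}_0$. If $s>0$, then \[ Z_q\big((0,k_1,\dots,k_r);(\ell_1,\dots,\ell_s);x\big)=Z_q\big((k_1,\dots,k_r);(\ell_1+1,\ell_2,\dots,\ell_s);x\big), \] and if $r>0$, then \[ Z_q\big((k_1+1,k_2,\dots,k_r);(\ell_1,\dots,\ell_s);x\big)=Z_q\big((k_1,\dots,k_r);(0,\ell_1,\ell_2,\dots,\ell_s);x\big), \] where both sides are understood as elements of $[0,+\infty]$.
   Context: $\mathbb{N}_0=\{0,1,2,\dots\}$. For indices $\mathbf{k}=(k_1,\dots,k_r)\in\mathbb{N}_0^r$, $\boldsymbol\ell=(\ell_1,\dots,\ell_s)\in\mathbb{N}_0^s$ ($r,s\geq0$), $0<q<1$ and real $x$ with $|x|<1$, the connected sum is \[ Z_q(\mathbf{k};\boldsymbol\ell;x):=\sum_{\substack{m_1>\dots>m_r>m_{r+1}=0\\ n_1>\dots>n_s>n_{s+1}=0}}\prod_{i=1}^r\frac{q^{m_ik_i}}{(1-q^{m_i}x)(1-q^{m_i})^{k_i}}\prod_{j=1}^s\frac{q^{n_j\ell_j}}{(1-q^{n_j}x)(1-q^{n_j})^{\ell_j}}\cdot\frac{q^{m_1n_1}f_q(m_1;x)f_q(n_1;x)}{f_q(m_1+n_1;x)}, \] where $f_q(m;x):=\prod_{h=1}^m(1-q^hx)$ (so $f_q(0;x)=1$; if $r=0$ then $m_1=0$,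 if $s=0$ then $n_1=0$). It is a series of positive terms, hence a value in $[0,+\infty]$. *)

(* Defs.v *)
From mathcomp Require Export all_boot all_order all_algebra.
From mathcomp Require Export all_classical all_reals.
From mathcomp Require Export esum.

Set Implicit Arguments.
Unset Strict Implicit.
Unset Printing Implicit Defensive.

Import Order.TTheory GRing.Theory Num.Theory.

Local Open Scope classical_set_scope.
Local Open Scope ring_scope.

Definition fq (R : realType) (q x : R) (m : nat) : R :=
  \prod_(1 <= h < m.+1) (1 - q ^+ h * x).

(* The tuples m_1 > ... > m_r > m_{r+1} = 0, as sequences of length r. *)
Definition decr_pos (r : nat) : set (seq nat) :=
  [set m | [&& size m == r, sorted gtn m & all (ltn 0) m]].

(* Positions are counted from 0: [nth 0%N m i] is m_{i+1}. *)
Definition index_prod (R : realType) (q x : R) (k m : seq nat) : R :=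
  \prod_(i < size k)
    (q ^+ (nth 0%N m i * nth 0%N k i) /
     ((1 - q ^+ nth 0%N m i * x) * (1 - q ^+ nth 0%N m i) ^+ nth 0%N k i)).

(* [head 0] implements the convention m_1 = 0 for an empty index. *)
Definition connector (R : realType) (q x : R) (m n : seq nat) : R :=
  q ^+ (head 0%N m * head 0%N n) * fq q x (head 0%N m) * fq q x (head 0%N n) /
  fq q x (head 0%N m + head 0%N n).

(* Every summand is positive when 0 < q < 1 and |x| < 1, so the unordered sum  *)
(* [esum] (the supremum of the finite partial sums) is the value of the series *)
(* in [0, +oo].                                                                *)
Definition Zq (R : realType) (q : R) (k l : seq nat) (x : R) : \bar R :=
  \esum_(mn in decr_pos (size k) `*` decr_pos (size l))
    (index_prod q x k mn.1 * index_prod q x l mn.2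
       * connector q x mn.1 mn.2)%:E.

(* Main.v *)
Require Import Defs.
From mathcomp Require Import ereal topology normedtype sequences.
From mathcomp Require Import ring.

Import Order.TTheory GRing.Theory Num.Theory.
Import numFieldNormedType.Exports.

Local Open Scope ring_scope.

(** The summand of Z_q(0, k; l; x) depends on the outermost variable m_0 only
    through the connector C(m, n) = q^(mn) f(m) f(n) / f(m + n), and
      C(m, n) / (1 - q^m x) = q^n / (1 - q^n) * (C(m - 1, n) - C(m, n)).
    Since C(m, n) tends to 0 as m grows when n > 0, the sum over m_0 > m_1
    telescopes to q^(n_1) / (1 - q^(n_1)) * C(m_1, n_1), which raises l_1 by
    one.  The second identity follows from the first by exchanging k and l. *)

Section ConnectedSum.

Context (R : realType) (q x : R).
Hypotheses (q_gt0 : 0 < q) (q_lt1 : q < 1) (x_lt1 : `|x| < 1).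

Definition conn (m n : nat) : R :=
  q ^+ (m * n) * fq q x m * fq q x n / fq q x (m + n).

Lemma conn_sym m n : conn m n = conn n m.
Proof. by rewrite /conn mulnC addnC -!mulrA [fq q x m * _]mulrCA. Qed.

Lemma ler_1BqX h : 1 - `|x| <= 1 - q ^+ h * x.
Proof.
rewrite lerD2l lerN2 (le_trans (ler_norm _))// normrM normrX (gtr0_norm q_gt0).
by rewrite ler_piMl// exprn_ile1 ?(ltW q_gt0) ?(ltW q_lt1).
Qed.

Lemma gtr0_1BqX h : 0 < 1 - q ^+ h * x.
Proof. by apply: lt_le_trans (ler_1BqX h); rewrite subr_gt0. Qed.

Lemma fqS m : fq q x m.+1 = fq q x m * (1 - q ^+ m.+1 * x).
Proof. by rewrite /fq big_nat_recr. Qed.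

Lemma fq_gt0 m : 0 < fq q x m.
Proof. by apply: prodr_gt0 => h _; exact: gtr0_1BqX. Qed.

(** Each of the [n] extra factors is at least $1-|x|$; the resulting bound on $f(m)/f(m+n)$ is
    uniform in [m]. *)
Lemma fqD_ge m n : fq q x m * (1 - `|x|) ^+ n <= fq q x (m + n).
Proof.
elim: n => [|n IHn]; first by rewrite mulr1 addn0.
rewrite addnS fqS exprSr mulrA ler_pM ?ler_1BqX//.
  by rewrite mulr_ge0 ?exprn_ge0 ?(ltW (fq_gt0 _))// subr_ge0 ltW.
by rewrite subr_ge0 ltW.
Qed.

Lemma conn_ge0 m n : 0 <= conn m n.
Proof.
by rewrite !mulr_ge0 ?invr_ge0 ?exprn_ge0 ?(ltW (fq_gt0 _)) ?(ltW q_gt0).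
Qed.

(** After the common factors are cleared, this is $(1-q^{m+n+1}x)-q^n(1-q^{m+1}x)=1-q^n$. *)
Lemma conn_step m n : (0 < n)%N ->
  conn m.+1 n / (1 - q ^+ m.+1 * x) =
  q ^+ n / (1 - q ^+ n) * (conn m n - conn m.+1 n).
Proof.
move=> n_gt0; have qn_neq0 : 1 - q ^+ n != 0.
  by rewrite subr_eq0 eq_sym lt_eqF// exprn_ilt1// -?lt0n// ltW.
rewrite /conn addSn !fqS mulSn -addSn !exprD.
have := gtr0_1BqX m.+1; have := gtr0_1BqX (m + n).+1.
rewrite -addSn exprD => /lt0r_neq0 ? /lt0r_neq0 ?.
have /lt0r_neq0 ? := fq_gt0 (m + n).
by field; do !(apply/andP; split).
Qed.

Lemma conn_le m j n : (0 < n)%N ->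
  conn (m + j) n <= fq q x n / (1 - `|x|) ^+ n * q ^+ j.
Proof.
move=> n_gt0; have x1_gt0 : 0 < (1 - `|x|) ^+ n by rewrite exprn_gt0// subr_gt0.
rewrite /conn ler_pdivrMr ?fq_gt0//.
(* Since $n\geq1$, the exponent is at least [j]; this is the source of the decay. *)
have le_q : q ^+ ((m + j) * n) <= q ^+ j.
  apply: ler_wiXn2l; [exact: ltW|exact: ltW|].
  by rewrite (leq_trans (leq_addl m j))// leq_pmulr.
set F := fq q x n; set G := fq q x (m + j).
rewrite [leLHS](_ : _ = F * G * q ^+ ((m + j) * n)); last by rewrite /=; ring.
rewrite [leRHS](_ : _ = F * (fq q x (m + j + n) / (1 - `|x|) ^+ n) * q ^+ j);
  last by rewrite /=; ring.
rewrite ler_pM ?exprn_ge0 ?mulr_ge0 ?(ltW (fq_gt0 _)) ?(ltW q_gt0)//.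
by rewrite ler_pM2l ?fq_gt0// ler_pdivlMr// fqD_ge.
Qed.

Lemma cvg_conn m n : (0 < n)%N -> (conn (m + j) n @[j --> \oo] --> 0)%classic.
Proof.
move=> n_gt0; pose K := fq q x n / (1 - `|x|) ^+ n.
apply: (@squeeze_cvgr _ _ _ _ (cst 0) (geometric K q)).
- by apply: nearW => j; rewrite conn_ge0 conn_le.
- exact: cvg_cst.
- by apply: cvg_geometric; rewrite gtr0_norm.
Qed.

(** This is the telescoping sum over $m_0=m+j+1$; [c] stands for the factors that do not involve
    $m_0$. *)
Lemma esum_conn m n (c : R) : (0 < n)%N -> 0 <= c ->
  (\esum_(j in [set: nat])
     (c * (conn (m + j).+1 n / (1 - q ^+ (m + j).+1 * x)))%:E)%E =
  (c * (q ^+ n / (1 - q ^+ n)) * conn m n)%:E.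
Proof.
move=> n_gt0 c_ge0; pose d := c * (q ^+ n / (1 - q ^+ n)).
(* The sign makes [f] nondecreasing with limit 0, so the sum of its increments is $-f(0)$. *)
pose f j := - (d * conn (m + j) n).
have term_ge0 j : 0 <= c * (conn (m + j).+1 n / (1 - q ^+ (m + j).+1 * x)).
  by rewrite mulr_ge0// divr_ge0 ?conn_ge0// ltW// gtr0_1BqX.
have fE j : c * (conn (m + j).+1 n / (1 - q ^+ (m + j).+1 * x)) = f j.+1 - f j.
  by rewrite conn_step// /f addnS /d; ring.
have f_lim : (limn (EFin \o f) = 0)%E.
  apply/cvg_lim => //; apply: cvg_EFin; first exact: nearW.
  have -> : 0 = - (d * 0) :> R by rewrite mulr0 oppr0.
  by apply: cvgN; apply: cvgMl_tmp; exact: cvg_conn.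
rewrite -nneseries_esumT => [|j]; last by rewrite lee_fin.
transitivity (\sum_(0 <= j <oo) ((f j.+1)%:E - (f j)%:E))%E.
  by apply: eq_eseriesr => j _; rewrite fE EFinB.
rewrite (@nondecreasing_telescope_sumey _ _ f) ?f_lim//.
  by rewrite sub0e -EFinN /f opprK addn0.
apply/nondecreasing_seqP => j.
by rewrite -subr_ge0 -fE.
Qed.

Lemma index_prod_cons a k b m : index_prod q x (a :: k) (b :: m) =
  q ^+ (b * a) / ((1 - q ^+ b * x) * (1 - q ^+ b) ^+ a) * index_prod q x k m.
Proof. by rewrite /index_prod big_ord_recl. Qed.

Lemma index_prod_incr_nth l n : (0 < size l)%N -> (0 < size n)%N ->
  index_prod q x (incr_nth l 0) n =
  index_prod q x l n * (q ^+ head 0%N n / (1 - q ^+ head 0%N n)).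
Proof.
case: l n => [|a l] [|b n]//= _ _; rewrite !index_prod_cons mulnS exprD exprS.
by rewrite !invfM; ring.
Qed.

Lemma index_prod_ge0 k m : 0 <= index_prod q x k m.
Proof.
apply: prodr_ge0 => i _.
rewrite mulr_ge0 ?invr_ge0 ?exprn_ge0 ?(ltW q_gt0)// mulr_ge0//.
  by rewrite ltW// gtr0_1BqX.
by rewrite exprn_ge0// subr_ge0 exprn_ile1 ?(ltW q_gt0) ?(ltW q_lt1).
Qed.

(** The default 0 of [head] plays the part of $m_{r+1}=0$: for empty [m] the inequality says that
    [a] is positive, and otherwise positivity of [a] follows from that of the head. *)
Lemma decr_pos_cons r a m :
  decr_pos r.+1 (a :: m) <-> decr_pos r m /\ (head 0%N m < a)%N.
Proof.
rewrite /decr_pos /= eqSS; case: m => [|b m] /=.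
  by rewrite !andbT; split=> [/andP[]|[-> ->]].
split=> [/and4P[-> /andP[-> ->] _ ->]//|[/and3P[-> -> /andP[b0 ->]] ba]].
by rewrite ba b0 (leq_ltn_trans _ ba).
Qed.

Lemma decr_pos_head_gt0 r m : decr_pos r m -> (0 < r)%N -> (0 < head 0%N m)%N.
Proof. by case: m => [|a m] /and3P[/eqP<-]//= _ /andP[]. Qed.

Lemma decr_pos_size r m : decr_pos r m -> size m = r.
Proof. by move=> /and3P[/eqP]. Qed.

(** Writing $m_0=m_1+j+1$ turns the constraint $m_0>m_1$ into a free $j\in\mathbb{N}_0$. *)
Lemma set_bij_decr_pos_cons r s :
  set_bij ((decr_pos r `*` decr_pos s) `*`` (fun=> [set: nat]))%classic
    (decr_pos r.+1 `*` decr_pos s)%classic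
    (fun p => ((head 0%N p.1.1 + p.2).+1 :: p.1.1, p.1.2)).
Proof.
split=> [[[m n] j] [[/= dm dn] _]||[[|a m] n] [/= dm dn]].
- by split=> //=; apply/decr_pos_cons; rewrite ltnS leq_addr.
- by move=> [[m n] j] [[m' n'] j'] _ _ [+ mm' ->]; rewrite mm' => /addnI->.
- by case/and3P: dm.
- move/decr_pos_cons: dm => [dm ltma].
  exists ((m, n), a - (head 0%N m).+1)%N => //=.
  by rewrite -addSn subnKC.
Qed.

Lemma Zq_cons0 k l : (0 < size l)%N ->
  Zq q (0%N :: k) l x = Zq q k (incr_nth l 0) x.
Proof.
move=> l_gt0; rewrite /Zq size_incr_nth l_gt0.
rewrite (@reindex_esum _ _ _ _ _ _ _ (set_bij_decr_pos_cons _ _)).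
(* The exponent 0 contributes only $1/(1-q^{m_0}x)$, which is grouped with the connector to match
   [conn_step]. *)
set F := fun mn : seq nat * seq nat => fun j =>
  ((index_prod q x k mn.1 * index_prod q x l mn.2) *
   (conn (head 0%N mn.1 + j).+1 (head 0%N mn.2) /
      (1 - q ^+ (head 0%N mn.1 + j).+1 * x)))%:E.
transitivity (\esum_(p in ((decr_pos (size k) `*` decr_pos (size l)) `*``
    (fun=> [set: nat]))%classic) F p.1 p.2)%E.
  apply: eq_esum => -[[m n] j] _ /=; rewrite /F /=; congr EFin.
  rewrite index_prod_cons muln0 !expr0 mulr1 mul1r /conn /connector /=.
  by ring.
(* All terms are nonnegative, so the sum over [j] may be taken first. *)
rewrite -esum_esum => [|mn j _ _]; last first.
  rewrite lee_fin; apply: mulr_ge0; first by rewrite mulr_ge0 ?index_prod_ge0.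
  by rewrite divr_ge0 ?conn_ge0// ltW// gtr0_1BqX.
apply: eq_esum => -[m n] [/= dm dn].
(* Here $n_1>0$ because [l] is nonempty. *)
rewrite esum_conn ?(decr_pos_head_gt0 _ _ dn)// ?mulr_ge0 ?index_prod_ge0//.
have n_gt0 : (0 < size n)%N by rewrite (decr_pos_size _ _ dn).
by rewrite index_prod_incr_nth// !mulrA.
Qed.

(** Swapping the two tuples is a bijection, and the connector is symmetric. *)
Lemma Zq_sym k l : Zq q k l x = Zq q l k x.
Proof.
rewrite /Zq (@reindex_esum _ _ _ (decr_pos (size l) `*` decr_pos (size k))%classic
  _ (fun p => (p.2, p.1))); last first.
  split=> [[m n] []//|[m n] [m' n'] _ _ [-> ->]//|[m n] [dm dn]].
  by exists (n, m).
apply: eq_esum => -[m n] _ /=; congr EFin.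
by rewrite [connector q x n m]conn_sym [index_prod _ _ k n * _]mulrC.
Qed.

End ConnectedSum.

Theorem mainTheorem2 (R : realType) (q x : R) (r s : nat)
    (k : r.-tuple nat) (l : s.-tuple nat) :
  0 < q -> q < 1 -> `|x| < 1 ->
  ((0 < s)%N -> Zq q (0%N :: k) l x = Zq q k (incr_nth l 0) x) /\
  ((0 < r)%N -> Zq q (incr_nth k 0) l x = Zq q k (0%N :: l) x).
Proof.
move=> q_gt0 q_lt1 x_lt1; split=> [s_gt0|r_gt0].
  by rewrite Zq_cons0// size_tuple.
by rewrite Zq_sym -Zq_cons0 ?size_tuple// Zq_sym.
Qed.
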